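(* Let $N\geq 2$ and let $\rho$ be the unique positive real root of $X^N-X^{N-1}-\cdots-X-1$. Let $x>y$ be consecutive $\rho$-integers (i.e. no $\rho$-integer lies strictly between $y$ and $x$). (1) If $y=0$, then $x=1$. (2) Suppose $y\neq 0$. Write the normal form representations of $x$ and $y$ (as formal sums of distinct powers $\rho^j$, $j\geq0$) as $x=z+\tilde x$ and $y=z+\tilde y$, where $z$ is the sum of the terms $\rho^j$ common to both representations with exponent $j$ larger than the largest exponent at which the two representations differ, and $\tilde x,\tilde y$ are the sums of the remaining terms. If $\tilde y=0$, then $\tilde x=1$. If $\tilde y\neq 0$, then $\tilde x$ has higher degree than $\tilde y$, and, denoting by $n$ the degree of $\tilde y$ and by $r$ the remainder upon division of $n+1$ by $N$, \[ x-y=\sum_{i=r+1}^N\rho^{r-i}=\frac1\rho+\cdots+\frac1{\rho^{N-r}}. \]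
   Context: A non-negative real number is a $\rho$-integer if it equals $\sum_{i=0}^{n}c_i\rho^{n-i}$ for some $n\in\mathbb N_0$ and $c_i\in\{0,1\}$. A representation $\rho^n+\sum_{i=1}^n c_i\rho^{n-i}$ with $c_i\in\{0,1\}$ is in normal form if, setting $c_0=1$ and $c_k=0$ for $k>n$, every block $c_j,\dots,c_{j+N-1}$ ($j\ge0$) of $N$ consecutive coefficients contains a zero. Every nonzero $\rho$-integer has a unique normal form representation; the degree of a nonzero $\rho$-integer (or of such a partial sum) is the largest exponent of $\rho$ occurring in it. *)

(* Defs.v *)
From HB Require Import structures.
From mathcomp Require Import all_boot all_order all_algebra.
From mathcomp Require Import reals.

Set Implicit Arguments.
Unset Strict Implicit.
Unset Printing Implicit Defensive.

Import Order.TTheory GRing.Theory Num.Theory.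
Local Open Scope ring_scope.

(* X^N - X^(N-1) - ... - X - 1 *)
Definition nbonacci_poly (R : realType) (N : nat) : {poly R} :=
  'X^N - \sum_(i < N) 'X^i.

Definition rho_integer (R : realType) (rho x : R) : Prop :=
  0 <= x /\ exists (n : nat) (c : nat -> bool),
    x = \sum_(i < n.+1) (c i)%:R * rho ^+ (n - i).

Definition consecutive (R : realType) (rho y x : R) : Prop :=
  [/\ rho_integer rho y, rho_integer rho x, y < x &
      forall w : R, rho_integer rho w -> ~ (y < w < x)].

Definition normal_coefs (N n : nat) (c : nat -> bool) : Prop :=
  [/\ c 0%N = true,
      forall k : nat, (n < k)%N -> c k = false &
      forall j : nat, exists2 i : nat, (j <= i < j + N)%N & c i = false].

(* A formal sum of distinct powers of rho is encoded as the polynomial with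
   coefficients in {0, 1} in which 'X stands for rho.  Coefficients c_i are
   indexed from the leading term down, so c_i multiplies 'X^(n - i). *)
Definition formal_sum (R : realType) (n : nat) (c : nat -> bool) : {poly R} :=
  \sum_(i < n.+1) (c i)%:R *: 'X^(n - i).

Definition normal_form_of (R : realType) (N : nat) (rho x : R)
    (p : {poly R}) : Prop :=
  exists (n : nat) (c : nat -> bool),
    [/\ normal_coefs N n c, p = formal_sum R n c & x = p.[rho]].

Definition largest_difference (R : realType) (p q : {poly R}) (m : nat) : Prop :=
  p`_m <> q`_m /\ forall j : nat, (m < j)%N -> p`_j = q`_j.

Definition common_terms_above (R : realType) (p q : {poly R}) (m : nat) :
    {poly R} :=
  \sum_(m.+1 <= j < size p | (p`_j == 1) && (q`_j == 1)) 'X^j.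

(* Largest exponent occurring; meaningful for p <> 0 only. *)
Definition deg (R : realType) (p : {poly R}) : nat := (size p).-1.

(* Main.v *)
(** Write rho-integers by their 0/1 digits.  Among digit strings of length k
    without N consecutive ones, the value is maximised by 1^(N-1) 0 1^(N-1) 0 ...
    read from the top, and this maximum falls short of rho^k by
    1/rho + ... + 1/rho^(N - k mod N) > 0.  Hence normal forms are ordered
    lexicographically.  If m is the largest exponent where the normal forms of
    x > y differ, x has digit 1 there and y digit 0.  Replacing the digits at
    exponents <= m by other strings gives further rho-integers, and consecutiveness
    forces the part of x below m to vanish and the part of y below m to attain
    the maximum. *)
Require Import Defs.
From HB Require Import structures.
From mathcomp Require Import all_boot all_order all_algebra.
From mathcomp Require Import reals.
From mathcomp Require Import zify lra.

Set Implicit Arguments.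
Unset Strict Implicit.
Unset Printing Implicit Defensive.

Import Order.TTheory GRing.Theory Num.Theory.
Local Open Scope ring_scope.

(** Digits are indexed by exponent, with a free cutoff [L], so that numbers of different degrees can
    be compared at one common length. *)
Definition digit_sum (R : realType) (rho : R) (L : nat) (a : nat -> bool) : R :=
  \sum_(0 <= j < L) (a j)%:R * rho ^+ j.

Definition admissible (N : nat) (a : nat -> bool) : Prop :=
  forall j : nat, exists2 i : nat, (j <= i < j + N)%N & a i = false.

(* The amount by which the largest admissible digit string of length k misses
   rho^k. *)
Definition gap (R : realType) (N : nat) (rho : R) (k : nat) : R :=
  \sum_(1 <= i < (N - k %% N).+1) (rho ^+ i)^-1.

(** * Digit sums and rho-integers *)

Section DigitSums.
Variables (R : realType) (rho : R).
Implicit Types (a b d : nat -> bool).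
Hypothesis rho_gt0 : 0 < rho.

Lemma digit_sumS L a :
  digit_sum rho L.+1 a = digit_sum rho L a + (a L)%:R * rho ^+ L.
Proof. by rewrite /digit_sum big_nat_recr. Qed.

Lemma digit_sum0 L a : (forall j, (j < L)%N -> a j = false) ->
  digit_sum rho L a = 0.
Proof.
by move=> a0; rewrite /digit_sum big1_seq // => j; rewrite mem_index_iota =>
  /= jL; rewrite a0 ?mul0r.
Qed.

Lemma eq_digit_sum L a b : (forall j, (j < L)%N -> a j = b j) ->
  digit_sum rho L a = digit_sum rho L b.
Proof. by move=> ab; apply: eq_big_nat => j jL; rewrite ab. Qed.

Lemma digit_sum_ge0 L a : 0 <= digit_sum rho L a.
Proof. by apply: sumr_ge0 => j _; rewrite mulr_ge0 ?ler0n ?exprn_ge0 ?ltW. Qed.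

Lemma digit_sum_le_sum L a : digit_sum rho L a <= \sum_(0 <= j < L) rho ^+ j.
Proof.
apply: ler_sum => j _; case: (a j); rewrite ?mul1r // mul0r.
by rewrite exprn_ge0 ?ltW.
Qed.

Lemma digit_sum_ge_pow L a j : (j < L)%N -> a j -> rho ^+ j <= digit_sum rho L a.
Proof.
elim: L => // L IHL; rewrite ltnS leq_eqVlt digit_sumS => /orP[/eqP-> ->|jL aj].
  by rewrite mul1r lerDr digit_sum_ge0.
by apply: (le_trans (IHL jL aj)); rewrite lerDl mulr_ge0 ?ler0n ?exprn_ge0 ?ltW.
Qed.

(** Used to build competitors: the digits at exponents at most [m] are exchanged, those above are
    kept. *)
Lemma digit_sum_splice m L a d : (m < L)%N ->
  digit_sum rho L (fun j => if (j <= m)%N then d j else a j) =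
  digit_sum rho L a - digit_sum rho m.+1 a + digit_sum rho m.+1 d.
Proof.
elim: L => // L IHL; rewrite ltnS leq_eqVlt => /orP[/eqP<-|mL].
  rewrite subrr add0r; apply: eq_digit_sum => j; rewrite ltnS => -> //.
by rewrite digit_sumS IHL // leqNgt mL (digit_sumS L a) /=; lra.
Qed.

Lemma rho_integer_digit_sum L a : rho_integer rho (digit_sum rho L a).
Proof.
split; first exact: digit_sum_ge0.
(* The extra leading coefficient 0 also covers [L = 0], since a rho-integer has at least one
   coefficient. *)
exists L, (fun i => (0 < i)%N && a (L - i)%N).
rewrite big_ord_recl /= mul0r add0r /digit_sum big_nat_rev big_mkord.
by apply: eq_bigr => i _; rewrite add0n /= /bump.
Qed.

Lemma rho_integerP x : rho_integer rho x ->
  exists L a, x = digit_sum rho L a.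
Proof.
move=> [_ [n [c ->]]]; exists n.+1, (fun j => c (n - j)%N).
rewrite /digit_sum big_nat_rev big_mkord; apply: eq_bigr => i _.
by rewrite add0n subSS subKn // -ltnS.
Qed.

End DigitSums.

(** * The N-bonacci relation and extremal digit strings *)

Section Nbonacci.
Variables (R : realType) (N : nat) (rho : R).
Implicit Types (a d : nat -> bool).
Hypotheses (N_ge2 : (2 <= N)%N) (rho_gt0 : 0 < rho).
Hypothesis rho_root : root (nbonacci_poly R N) rho.

Lemma nbonacci_expN : rho ^+ N = \sum_(0 <= i < N) rho ^+ i.
Proof.
move: rho_root; rewrite rootE /nbonacci_poly !hornerE horner_sum subr_eq0.
move/eqP->; rewrite big_mkord; apply: eq_bigr => i _; by rewrite hornerXn.
Qed.

Lemma nbonacci_gt1 : 1 < rho.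
Proof.
rewrite ltNge; apply/negP => rho_le1.
have := nbonacci_expN; case: N N_ge2 => [|[|M]] // _ e.
have : 1 < rho ^+ M.+2.
  rewrite e big_nat_recl // big_nat_recl // expr0 ltrDl ltr_wpDr ?expr1 //.
  by apply: sumr_ge0 => i _; rewrite exprn_ge0 ?ltW.
by rewrite ltNge exprn_ile1 // ltW.
Qed.

Lemma nbonacci_expD k : rho ^+ (k + N) = \sum_(k <= j < k + N) rho ^+ j.
Proof.
rewrite exprD nbonacci_expN mulr_sumr -{2}[k]add0n big_addn addKn.
by apply: eq_bigr => i _; rewrite -exprD addnC.
Qed.

(** Multiplied by [rho ^+ (N - k)], both sides become the sum of the lowest [N - k] powers in the
    expansion of [rho ^+ N]. *)
Lemma gapE k : (k <= N)%N ->
  \sum_(1 <= i < (N - k).+1) (rho ^+ i)^-1 = rho ^+ k - \sum_(0 <= j < k) rho ^+ j.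
Proof.
move=> kN; set s := (N - k)%N.
have uX i : rho ^+ i \is a GRing.unit by rewrite unitfE expf_neq0 ?gt_eqF.
apply: (mulIr (uX s)); rewrite mulrBl -exprD subnKC //.
have -> : rho ^+ N = \sum_(0 <= i < s) rho ^+ i + \sum_(s <= i < N) rho ^+ i.
  by rewrite -big_cat_nat ?leq_subr // -nbonacci_expN.
have -> : (\sum_(0 <= j < k) rho ^+ j) * rho ^+ s = \sum_(s <= i < N) rho ^+ i.
  rewrite -{2}[s]add0n big_addn subKn // mulr_suml.
  by apply: eq_bigr => i _; rewrite exprD.
rewrite addrK mulr_suml big_nat_rev /= -{1}[1%N]add0n big_addn subn1 /=.
apply: eq_big_nat => i /andP[_ iS].
have -> : (1 + s.+1 - (i + 1).+1 = s - i)%N by lia.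
by rewrite -{2}(subnKC (ltnW iS)) exprD mulrCA mulVr ?mulr1.
Qed.

Lemma gap_small k : (k < N)%N ->
  gap N rho k = rho ^+ k - \sum_(0 <= j < k) rho ^+ j.
Proof. by move=> kN; rewrite /gap modn_small // gapE // ltnW. Qed.

Lemma gapD k : gap N rho (k + N) = gap N rho k.
Proof. by rewrite /gap modnDr. Qed.

Lemma gap_gt0 k : 0 < gap N rho k.
Proof.
have kN : (k %% N < N)%N by rewrite ltn_mod; lia.
rewrite /gap big_ltn ?ltnS ?subn_gt0 // ltr_wpDr ?invr_gt0 ?exprn_gt0 //.
by apply: sumr_ge0 => i _; rewrite invr_ge0 exprn_ge0 ?ltW.
Qed.

(** The gap is an initial segment of 1/rho + ... + 1/rho^N, which equals 1 by [gapE] at [k = 0]. *)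
Lemma gap_le1 k : gap N rho k <= 1.
Proof.
have := gapE (leq0n N); rewrite subn0 [X in _ - X]big_geq // expr0 subr0 => <-.
rewrite [leRHS](big_cat_nat_idem _ (n := (N - k %% N).+1)) //=; last first.
- by rewrite ltnS leq_subr.
- exact: addr0.
by rewrite lerDl; apply: sumr_ge0 => i _; rewrite invr_ge0 exprn_ge0 ?ltW.
Qed.

Lemma digit_sum_prefix_le p k a : (p <= k)%N ->
  digit_sum rho k a <= digit_sum rho p a + \sum_(p <= j < k) rho ^+ j.
Proof.
move=> pk; rewrite /digit_sum (big_cat_nat (n := p)) //= lerD2l.
apply: ler_sum => j _; case: (a j); rewrite ?mul1r // mul0r.
by rewrite exprn_ge0 ?ltW.
Qed.

(* The extremal string is 1^(N-1) 0 1^(N-1) 0 ... read from the top; any zero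
   among the N leading digits already costs at least as much. *)
Lemma digit_sum_le_gap k a : admissible N a ->
  digit_sum rho k a <= rho ^+ k - gap N rho k.
Proof.
move=> adm; elim/ltn_ind: k => k IH; case: (ltnP k N) => kN.
  by rewrite gap_small // subKr digit_sum_le_sum.
pose q := (k - N)%N; have kE : k = (q + N)%N by rewrite subnK.
have [p /andP[qp pk] ap] := adm q; rewrite -kE in pk.
have pS : digit_sum rho p.+1 a = digit_sum rho p a.
  by rewrite digit_sumS ap mul0r addr0.
have := IH p pk; have := digit_sum_prefix_le a pk; rewrite pS.
have -> : gap N rho k = gap N rho q by rewrite kE gapD.
have -> : rho ^+ k = \sum_(q <= j < p) rho ^+ j + (rho ^+ p +
    \sum_(p.+1 <= j < k) rho ^+ j).
  by rewrite {1}kE nbonacci_expD -kE (big_cat_nat (n := p)) //= 1?ltnW // (big_ltn pk).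
(* A zero at [q] reduces to the induction hypothesis at [q]. For a higher zero, the spare term
   [rho ^+ q >= 1] pays for [gap N rho q <= 1]. *)
move: qp; rewrite leq_eqVlt => /orP[/eqP<-|qp].
  by rewrite [X in X + (_ + _)]big_geq //; lra.
rewrite (big_ltn qp).
have : 0 <= \sum_(q.+1 <= i < p) rho ^+ i.
  by apply: sumr_ge0 => i _; rewrite exprn_ge0 ?ltW.
have := gap_gt0 p; have := gap_le1 q.
have : 1 <= rho ^+ q by rewrite exprn_ege1 // ltW // nbonacci_gt1.
lra.
Qed.

Lemma digit_sum_lt k a : admissible N a -> digit_sum rho k a < rho ^+ k.
Proof.
by move=> /(digit_sum_le_gap k); have := gap_gt0 k; lra.
Qed.

(** Any 0/1 digits give a rho-integer, so only the value of [d] matters when it serves as a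
    competitor. *)
Lemma gap_attained k : exists d, digit_sum rho k d = rho ^+ k - gap N rho k.
Proof.
elim/ltn_ind: k => k IH; case: (ltnP k N) => kN.
  exists xpredT; rewrite gap_small // subKr; apply: eq_bigr => j _.
  by rewrite mul1r.
pose q := (k - N)%N; have kE : k = (q + N)%N by rewrite subnK.
have qk : (q < k)%N by lia.
have [d dE] := IH q qk.
(* The top block is 1^(N-1) 0, with its zero at [q]; below it comes the string for [q]. *)
exists (fun j => if (j < q)%N then d j else j != q).
rewrite /digit_sum (big_cat_nat (n := q)) //= 1?ltnW // (big_ltn qk).
have -> : gap N rho k = gap N rho q by rewrite kE gapD.
have -> : rho ^+ k = \sum_(q <= j < k) rho ^+ j by rewrite kE nbonacci_expD.
rewrite ltnn eqxx mul0r add0r (big_ltn qk).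
have -> : \sum_(0 <= i < q) (if (i < q)%N then d i else i != q)%:R * rho ^+ i =
    rho ^+ q - gap N rho q.
  by rewrite -dE; apply: eq_digit_sum => j ->.
have -> : \sum_(q.+1 <= i < k) (if (i < q)%N then d i else i != q)%:R * rho ^+ i =
    \sum_(q.+1 <= i < k) rho ^+ i.
  apply: eq_big_nat => i /andP[qi _].
  by rewrite ltnNge (ltnW qi) /= gtn_eqF // mul1r.
lra.
Qed.

Lemma consecutive0 x : consecutive rho 0 x -> x = 1.
Proof.
move=> [_ /rho_integerP[L [a xE]] x0 xmin].
have x_ge1 : 1 <= x.
  rewrite leNgt; apply/negP => x1.
  suff x00 : x = 0 by move: x0; rewrite x00 ltxx.
  rewrite xE; apply: digit_sum0 => j jL; apply/negP => aj.
  have := digit_sum_ge_pow rho_gt0 jL aj; rewrite -xE.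
  have : 1 <= rho ^+ j by rewrite exprn_ege1 // ltW // nbonacci_gt1.
  by lra.
apply/eqP; rewrite eq_le x_ge1 andbT leNgt; apply/negP => x1.
have int1 : rho_integer rho 1.
  have := rho_integer_digit_sum rho_gt0 1 xpredT.
  by rewrite /digit_sum big_nat1 mul1r.
by apply: (xmin 1 int1); rewrite ltr01.
Qed.

(** * Digits of two consecutive rho-integers *)

Section Consecutive.
Variables (x y : R) (a b : nat -> bool) (m L : nat).
Hypotheses (hxy : consecutive rho y x) (mL : (m < L)%N).
Hypotheses (adm_a : admissible N a) (adm_b : admissible N b).
Hypotheses (xE : x = digit_sum rho L a) (yE : y = digit_sum rho L b).
Hypotheses (ab_m : a m <> b m) (ab_gt : forall j, (m < j)%N -> a j = b j).

(** The value of the common part z. *)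
Let T := x - digit_sum rho m.+1 a.

Lemma consecutive_prefixr : y = T + digit_sum rho m.+1 b.
Proof.
rewrite yE /T xE -digit_sum_splice //; apply: eq_digit_sum => j _.
by case: leqP => // /ab_gt.
Qed.

Lemma consecutive_sandwich d : (y < T + digit_sum rho m.+1 d < x) -> False.
Proof.
have [_ _ _ xmin] := hxy; apply: xmin.
by rewrite /T xE -digit_sum_splice //; apply: rho_integer_digit_sum.
Qed.

(** Otherwise x < T + rho^m <= y, since an admissible tail below [m] stays under rho^m. *)
Lemma consecutive_lead : a m /\ b m = false.
Proof.
have [_ _ yx _] := hxy; have yT := consecutive_prefixr.
case am: (a m); case bm: (b m) => //; move: ab_m; rewrite am bm // => _.
move: yx; rewrite yT /T !digit_sumS am bm mul1r mul0r.
have := digit_sum_lt m adm_a; have := digit_sum_ge0 rho_gt0 m b.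
by lra.
Qed.

(** Otherwise T + rho^m lies strictly between y and x. *)
Lemma consecutive_low : digit_sum rho m a = 0.
Proof.
have [am bm] := consecutive_lead; have yT := consecutive_prefixr.
have a0 := digit_sum_ge0 rho_gt0 m a.
apply/eqP; rewrite eq_le a0 andbT leNgt; apply/negP => a_gt0.
apply: (consecutive_sandwich (d := fun j => j == m)).
have -> : digit_sum rho m.+1 (fun j => j == m) = rho ^+ m.
  rewrite digit_sumS eqxx mul1r digit_sum0 ?add0r // => j jm.
  by rewrite ltn_eqF.
rewrite yT /T !digit_sumS am bm mul1r mul0r.
have := digit_sum_lt m adm_b.
by move=> blt; apply/andP; split; lra.
Qed.

Lemma consecutive_diff : x - y = rho ^+ m - digit_sum rho m b.
Proof.
have [am bm] := consecutive_lead; rewrite consecutive_prefixr /T.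
by rewrite !digit_sumS am bm consecutive_low mul1r mul0r; lra.
Qed.

(** Here y = T and x = T + rho^m, so T + 1 would separate them if [m > 0]. *)
Lemma consecutive_unit : (forall j, (j < m)%N -> b j = false) -> m = 0%N.
Proof.
move=> b0; have [am bm] := consecutive_lead; have yT := consecutive_prefixr.
apply/eqP; rewrite -leqn0 leqNgt; apply/negP => m0.
apply: (consecutive_sandwich (d := fun j => j == 0%N)).
have -> : digit_sum rho m.+1 (fun j => j == 0%N) = 1.
  by rewrite /digit_sum big_nat_recl // mul1r big1 ?addr0 // => i _; rewrite mul0r.
rewrite yT /T !digit_sumS am bm consecutive_low (digit_sum0 _ b0) mul1r mul0r.
have : 1 < rho ^+ m by rewrite exprn_egt1 ?nbonacci_gt1 // -lt0n.
by move=> h; apply/andP; split; lra.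
Qed.

(** If the tail of y were not maximal, the maximal tail from [gap_attained], with digit 0 at [m],
    would give a rho-integer above y and still below x. *)
Lemma consecutive_sub_gap : x - y = gap N rho m.
Proof.
rewrite consecutive_diff; have [am bm] := consecutive_lead.
have [d dE] := gap_attained m; have yT := consecutive_prefixr.
have blt := digit_sum_le_gap m adm_b; have g0 := gap_gt0 m.
suff bge : rho ^+ m - gap N rho m <= digit_sum rho m b by lra.
rewrite leNgt; apply/negP => b_lt.
apply: (consecutive_sandwich (d := fun j => (j < m)%N && d j)).
have -> : digit_sum rho m.+1 (fun j => (j < m)%N && d j) = digit_sum rho m d.
  rewrite digit_sumS ltnn mul0r addr0; apply: eq_digit_sum => j jm.
  by rewrite jm.
rewrite yT /T !digit_sumS am bm consecutive_low mul1r mul0r dE.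
by apply/andP; split; lra.
Qed.

(** This fixes the degree of the remainder of y as [m.-1]. With a zero there, T + rho^(m-1) would
    separate y from x. *)
Lemma consecutive_next : (0 < m)%N -> b m.-1.
Proof.
move=> m0; apply/negP => /negP/negPf bm1.
have [am bm] := consecutive_lead; have yT := consecutive_prefixr.
have mE : m = m.-1.+1 by rewrite prednK.
have bE : digit_sum rho m b = digit_sum rho m.-1 b.
  by rewrite {1}mE digit_sumS bm1 mul0r addr0.
apply: (consecutive_sandwich (d := fun j => j == m.-1)).
have -> : digit_sum rho m.+1 (fun j => j == m.-1) = rho ^+ m.-1.
  rewrite digit_sumS [m == _]gtn_eqF ?prednK // mul0r addr0 {1}mE digit_sumS eqxx.
  by rewrite mul1r digit_sum0 ?add0r // => j jm; rewrite ltn_eqF.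
have := digit_sum_lt m.-1 adm_b.
have : rho ^+ m.-1 < rho ^+ m by rewrite ltr_eXn2l ?nbonacci_gt1 // prednK.
rewrite yT /T !digit_sumS am bm consecutive_low bE mul1r mul0r.
by move=> h1 h2; apply/andP; split; lra.
Qed.

End Consecutive.

End Nbonacci.

(** * From formal sums to digit strings *)

Lemma normal_form_digits (R : realType) (N : nat) (rho x : R) (p : {poly R}) :
  (0 < N)%N -> normal_form_of N rho x p ->
  exists a, [/\ admissible N a, forall j, p`_j = (a j)%:R &
    forall L, (size p <= L)%N -> x = digit_sum rho L a].
Proof.
move=> N0 [n [c [[c0 cn cN] pE xE]]].
pose a j := (j <= n)%N && c (n - j)%N.
have pa j : p`_j = (a j)%:R.
  have -> : p = \poly_(i < n.+1) (a i)%:R.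
    rewrite pE /formal_sum poly_def (reindex_inj rev_ord_inj) /=.
    apply: eq_bigr => i _; have := ltn_ord i; rewrite ltnS => lein.
    by rewrite /a lein subSS subKn.
  by rewrite coef_poly ltnS /a; case: leqP.
exists a; split => //.
  (* A window of exponents within [0..n] is a reversed window of coefficients; any other window has
     its top exponent above [n], where the digit is 0. *)
  move=> j; case: (leqP (j + N) n.+1) => jn.
    have [i /andP[i1 i2] ci] := cN (n.+1 - (j + N))%N.
    exists (n - i)%N; first lia.
    by rewrite /a subKn ?ci ?andbF //; lia.
  exists (j + N).-1; first lia.
  by rewrite /a; case: leqP => //; lia.
move=> L pL; rewrite xE (horner_coef_wide _ pL) /digit_sum big_mkord.
by apply: eq_bigr => i _; rewrite pa.
Qed.

(** Above [m] the digits agree, so the common terms are exactly the terms of [p] there. *)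
Lemma coef_common_terms_above (R : realType) (p q : {poly R}) (a b : nat -> bool)
    (m : nat) :
  (forall j, p`_j = (a j)%:R) -> (forall j, q`_j = (b j)%:R) ->
  (forall j, (m < j)%N -> a j = b j) ->
  forall j, (common_terms_above p q m)`_j = ((m < j)%N && a j)%:R.
Proof.
move=> pa qb ab j; rewrite /common_terms_above coef_sum.
have eq1 (e : bool) : (e%:R == 1 :> R) = e by case: e; rewrite ?eqxx // eq_sym oner_eq0.
under eq_bigr do rewrite coefXn.
under eq_bigl do rewrite pa qb !eq1.
case: (boolP ((m < j)%N && a j)) => [/andP[mj aj]|mja].
  have jp : (j < size p)%N.
    by rewrite ltnNge; apply/negP => /leq_sizeP/(_ j (leqnn _))/eqP;
      rewrite pa aj oner_eq0.
  rewrite big_mkcond (bigD1_seq j) ?iota_uniq ?mem_index_iota ?mj //=.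
  rewrite -ab // aj eqxx big1 ?addr0 // => i; rewrite eq_sym => /negPf->.
  by case: ifP.
rewrite big1_seq // => i /andP[/andP[ai _]]; rewrite mem_index_iota => /andP[mi _].
by case: eqP => // ji; move: mja; rewrite ji mi ai.
Qed.

Lemma deg_eq (R : realType) (p : {poly R}) n :
  p`_n != 0 -> (forall j, (n < j)%N -> p`_j = 0) -> deg p = n.
Proof.
move=> pn pj; rewrite /deg; suff -> : size p = n.+1 by [].
apply/eqP; rewrite eqn_leq; apply/andP; split; first exact/leq_sizeP.
by rewrite ltnNge; apply/negP => /leq_sizeP/(_ n (leqnn _))/eqP; apply/negP.
Qed.

Theorem theorem3p13 (R : realType) (N : nat) (hN : (2 <= N)%N) (rho : R)
    (rho_gt0 : 0 < rho) (rho_root : root (nbonacci_poly R N) rho)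
    (x y : R) (hxy : consecutive rho y x) :
  (y = 0 -> x = 1) /\
  (y <> 0 ->
   forall (px py : {poly R}) (m : nat),
     normal_form_of N rho x px -> normal_form_of N rho y py ->
     largest_difference px py m ->
     let z := common_terms_above px py m in
     let tx := px - z in
     let ty := py - z in
     (ty = 0 -> tx = 1) /\
     (ty <> 0 ->
      (deg ty < deg tx)%N /\
      (let n := deg ty in
       let r := (n.+1 %% N)%N in
       x - y = \sum_(r.+1 <= i < N.+1) rho ^ (r%:Z - i%:Z) /\
       \sum_(r.+1 <= i < N.+1) rho ^ (r%:Z - i%:Z)
         = \sum_(1 <= k < (N - r).+1) (rho ^+ k)^-1))).
Proof.
split=> [y0|_ px py m nfx nfy [pq_m pq_gt] z tx ty].
  by apply: (consecutive0 hN rho_gt0 rho_root); rewrite -y0.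
have N0 : (0 < N)%N by exact: ltnW.
have [a [adm_a pa xE]] := normal_form_digits N0 nfx.
have [b [adm_b pb yE]] := normal_form_digits N0 nfy.
(* One cutoff beyond [m] and both degrees. *)
pose L := (m.+1 + size px + size py)%N.
have mL : (m < L)%N by rewrite /L; lia.
have {}xE : x = digit_sum rho L a by apply: xE; rewrite /L; lia.
have {}yE : y = digit_sum rho L b by apply: yE; rewrite /L; lia.
have ab_m : a m <> b m by move=> e; apply: pq_m; rewrite pa pb e.
have ab_gt j : (m < j)%N -> a j = b j.
  move=> /pq_gt; rewrite pa pb => /eqP.
  by case: (a j); case: (b j); rewrite // ?oner_eq0 // eq_sym oner_eq0.
have [am bm] := consecutive_lead hN rho_gt0 rho_root hxy mL adm_a xE yE ab_m ab_gt.
have txE j : tx`_j = ((j <= m)%N && a j)%:R.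
  rewrite coefB (coef_common_terms_above pa pb ab_gt) pa.
  by case: leqP => _; rewrite /= ?subr0 ?subrr.
have tyE j : ty`_j = ((j <= m)%N && b j)%:R.
  rewrite coefB (coef_common_terms_above pa pb ab_gt) pb.
  by case: leqP => [_|/ab_gt->]; rewrite /= ?subr0 ?subrr.
split=> [ty0|ty_neq0].
  have m0 : m = 0%N.
    apply: (consecutive_unit hN rho_gt0 rho_root hxy mL adm_a adm_b xE yE ab_m ab_gt).
    move=> j jm; have := tyE j; rewrite ty0 coef0 (ltnW jm) /= => /eqP.
    by case: (b j); rewrite // eq_sym oner_eq0.
  apply/polyP => j; rewrite txE coef1 m0 leqn0.
  by case: eqP => // ->; rewrite -m0 am.
have m0 : (0 < m)%N.
  rewrite lt0n; apply/eqP => m0; apply: ty_neq0; apply/polyP => j.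
  rewrite tyE coef0 m0 leqn0; case: eqP => // ->.
  by rewrite -m0 bm.
have bm1 := consecutive_next hN rho_gt0 rho_root hxy mL adm_a adm_b xE yE ab_m ab_gt m0.
have deg_tx : deg tx = m.
  apply: deg_eq => [|j mj]; first by rewrite txE leqnn am oner_eq0.
  by rewrite txE leqNgt mj.
have deg_ty : deg ty = m.-1.
  apply: deg_eq => [|j mj]; first by rewrite tyE leq_pred bm1 oner_eq0.
  rewrite tyE; have : (m <= j)%N by rewrite -(prednK m0).
  rewrite leq_eqVlt => /orP[/eqP<-|]; first by rewrite bm andbF.
  by rewrite ltnNge => /negPf->.
(* As [deg ty = m.-1], the number n + 1 is [m], and r is the residue occurring in [gap N rho m]. *)
rewrite deg_tx deg_ty /= prednK //; split; first by rewrite leqnn.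
set r := (m %% N)%N; have rN : (r < N)%N by rewrite ltn_mod.
have sumE : \sum_(r.+1 <= i < N.+1) rho ^ (r%:Z - i%:Z) =
    \sum_(1 <= k < (N - r).+1) (rho ^+ k)^-1.
  rewrite -[r.+1]addn1 addnC big_addn subSn 1?ltnW //; apply: eq_bigr => i _.
  by rewrite exprnN; congr (_ ^ _); lia.
split=> //; rewrite sumE.
exact: consecutive_sub_gap hxy mL adm_a adm_b xE yE ab_m ab_gt.
Qed.
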